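(* Let $n\ge1$ be an integer, let $a,b,m$ be constants, and work where $a\cosh mx+b\sinh mx\neq0$. The operational identity $$\prod_{k=n}^{0}\left(D-km\frac{a\sinh mx+b\cosh mx}{a\cosh mx+b\sinh mx}\right)=\left(a\cosh mx+b\sinh mx\right)^{n+1}\left(\frac1{a\cosh mx+b\sinh mx}D\right)^{n+1}$$ holds, and: (i) by virtue of this identity, the equation $$y_n''-\left(\lambda-\frac{n(n+1)m^2(a^2-b^2)}{(a\cosh mx+b\sinh mx)^2}\right)y_n=0,\qquad\lambda\neq0,$$ has general solution $$y_n=\left(a\cosh mx+b\sinh mx\right)^{n+1}\left(\frac1{a\cosh mx+b\sinh mx}D\right)^{n+1}y_0,$$ where $y_0$ is the general solution of $y_0''-\lambda y_0=0$, taken in one of its exponential, hyperbolic or trigonometric forms; (ii) if $\lambda=m^2(n+1)^2$, then by virtue of the factorization $$D^2-m^2(n+1)^2+\frac{n(n+1)m^2(a^2-b^2)}{(a\cosh mx+b\sinh mx)^2}=\left[D+m(n+1)\frac{a\sinh mx+b\cosh mx}{a\cosh mx+b\sinh mx}\right]\left[D-m(n+1)\frac{a\sinh mx+b\cosh mx}{a\cosh mx+b\sinh mx}\right]$$ the equation $$y''-m^2(n+1)^2y+\frac{n(n+1)m^2(a^2-b^2)}{(a\cosh mx+b\sinh mx)^2}y=0$$ has general solution $$y=(a\cosh mx+b\sinh mx)^{n+1}\left[c_1+c_2\int(a\cosh mx+b\sinh mx)^{-2(n+1)}dx\right].$$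
   Context: $D=d/dx$. A product $\prod_{k=n}^{0}L_k$ denotes the composition $L_nL_{n-1}\cdots L_0$ ($L_0$ is applied first). Functions act by multiplication, so $\frac1fD$ sends $y$ to $y'/f$. The forms of $y_0$ are $y_0=c_1e^{\sqrt\lambda x}+c_2e^{-\sqrt\lambda x}$; $y_0=c_1\cosh(\sqrt\lambda x)+c_2\sinh(\sqrt\lambda x)$ for $\lambda>0$; $y_0=c_1\cos(\sqrt{-\lambda}x)+c_2\sin(\sqrt{-\lambda}x)$ for $\lambda<0$. Here and in (ii), $c_1,c_2$ are arbitrary constants, and $\int$ denotes an antiderivative.
   Formalization: In (i) the formula is shown to give solutions for every λ≠0, but to be the general solution only when λ≠k²m² for k=1,…,n; for λ=k²m² it yields at most a one-parameter family (e.g. n=m=a=1, b=0, λ=1 gives (c1+c2)/cosh x). *)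

(* Defs.v *)
(* Stdlib reals with Coquelicot: complex-valued functions of a real variable. *)
From Stdlib Require Export Reals.
From Coquelicot Require Export Coquelicot.

Open Scope C_scope.

(* The theorem is stated both for complex constants and complex-valued
   functions, and for real constants and real-valued functions; real numbers
   are treated as the complex numbers with zero imaginary part. *)
Inductive scalars := real_scalars | complex_scalars.

Definition is_scalar (K : scalars) (z : C) : Prop :=
  match K with
  | real_scalars => Im z = 0%R
  | complex_scalars => True
  end.

Definition open_interval (l u : Rbar) (x : R) : Prop :=
  Rbar_lt l x /\ Rbar_lt x u.

Definition cexp (z : C) : C :=
  (exp (Re z) * cos (Im z), exp (Re z) * sin (Im z))%R.

Definition ccosh (z : C) : C := (cexp z + cexp (- z)) / 2.
Definition csinh (z : C) : C := (cexp z - cexp (- z)) / 2.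

Definition operator := (R -> C) -> (R -> C).

(* Coquelicot has a total derivative operator only for functions R -> R, hence
   the componentwise definition; D_correct relates it to is_derive. *)
Definition D : operator := fun y x =>
  (Derive (fun t => Re (y t)) x, Derive (fun t => Im (y t)) x).

Notation ex_deriveC y x := (ex_derive (V := C_R_NormedModule) y x).
Notation is_deriveC y x l := (is_derive (V := C_R_NormedModule) y x l).

Lemma D_correct (y : R -> C) (x : R) : ex_deriveC y x -> is_deriveC y x (D y x).
Proof.
  intros [l Hl].
  assert (H1 : is_derive (fun t => Re (y t)) x (Re l)).
  { apply (filterdiff_ext_lin _ (fun h : R => fst (scal h l : C_R_NormedModule))).
    - apply (filterdiff_comp (V := C_R_NormedModule) y (fun z => fst z) _ (fun z => fst z) Hl).
      apply (filterdiff_linear (U := C_R_NormedModule) (fun z => fst z)).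
      exact is_linear_fst.
    - reflexivity. }
  assert (H2 : is_derive (fun t => Im (y t)) x (Im l)).
  { apply (filterdiff_ext_lin _ (fun h : R => snd (scal h l : C_R_NormedModule))).
    - apply (filterdiff_comp (V := C_R_NormedModule) y (fun z => snd z) _ (fun z => snd z) Hl).
      apply (filterdiff_linear (U := C_R_NormedModule) (fun z => snd z)).
      exact is_linear_snd.
    - reflexivity. }
  replace (D y x) with l; [exact Hl|].
  apply is_derive_unique in H1, H2.
  unfold D; rewrite (surjective_pairing l).
  symmetry; exact (f_equal2 pair H1 H2).
Qed.

Fixpoint differentiable_on (n : nat) (I : R -> Prop) (y : R -> C) : Prop :=
  match n with
  | O => True
  | S n' => (forall x, I x -> ex_deriveC y x) /\ differentiable_on n' I (D y)
  end.

(* f D *)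
Definition scaled_D (f : R -> C) : operator := fun y x => f x * D y x.

(* D + p *)
Definition D_plus (p : R -> C) : operator := fun y x => D y x + p x * y x.

(* D - p *)
Definition D_minus (p : R -> C) : operator := fun y x => D y x - p x * y x.

(* L n (L (n-1) ( ... (L 0 y))) *)
Fixpoint compose_down (L : nat -> operator) (n : nat) : operator :=
  fun y =>
  match n with
  | O => L O y
  | S n' => L n (compose_down L n' y)
  end.

Definition w (a b m : C) (x : R) : C :=
  a * ccosh (m * x) + b * csinh (m * x).

Definition w_conj (a b m : C) (x : R) : C :=
  a * csinh (m * x) + b * ccosh (m * x).

(* y |-> w^(n+1) ((1/w) D)^(n+1) y *)
Definition T (n : nat) (a b m : C) : operator := fun y x =>
  w a b m x ^ (n + 1) *
  Nat.iter (n + 1) (scaled_D (fun t => 1 / w a b m t)) y x.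

Definition potential (n : nat) (a b m : C) (x : R) : C :=
  INR n * (INR n + 1) * m ^ 2 * (a ^ 2 - b ^ 2) / w a b m x ^ 2.

(* y is a solution on I of the second-order equation E y = 0 *)
Definition solves (I : R -> Prop) (E : operator) (y : R -> C) : Prop :=
  differentiable_on 2 I y /\ forall x, I x -> E y x = 0.

(* On I, the K-valued solutions of E y = 0 are exactly the functions
   Y c1 c2 with arbitrary constants c1, c2 in K. *)
Definition general_solution (K : scalars) (I : R -> Prop) (E : operator)
    (Y : C -> C -> R -> C) : Prop :=
  forall y : R -> C, (forall x, I x -> is_scalar K (y x)) ->
    (solves I E y <->
     exists c1 c2 : C, is_scalar K c1 /\ is_scalar K c2 /\
       forall x, I x -> y x = Y c1 c2 x).

(* The exponential form is available whenever lambda has a square root s in K: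
   for every lambda over the complex numbers, only for lambda >= 0 over the
   reals. *)
Inductive y0_form (K : scalars) (lambda : C) : (C -> C -> R -> C) -> Prop :=
| exponential_form (s : C) :
    is_scalar K s -> s ^ 2 = lambda ->
    y0_form K lambda
      (fun c1 c2 x => c1 * cexp (s * x) + c2 * cexp (- (s * x)))
| hyperbolic_form (r : R) :
    (0 < r)%R -> lambda = RtoC r ->
    y0_form K lambda
      (fun c1 c2 x => c1 * RtoC (cosh (sqrt r * x)) + c2 * RtoC (sinh (sqrt r * x)))
| trigonometric_form (r : R) :
    (r < 0)%R -> lambda = RtoC r ->
    y0_form K lambda
      (fun c1 c2 x => c1 * RtoC (cos (sqrt (- r) * x)) + c2 * RtoC (sin (sqrt (- r) * x))).

Definition antiderivative (K : scalars) (I : R -> Prop) (f F : R -> C) : Prop :=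
  forall x, I x -> is_scalar K (F x) /\ is_deriveC F x (f x).

(* Main.v *)
Require Import Defs.
From Stdlib Require Import Lra Lia Classical.

(** Put p = w'/w = m h.  Since w'' = m^2 w, the function p satisfies the Riccati
    equation p' = mu - p^2 with mu = m^2 ([w_riccati]), and the hyperbolic
    Pythagorean identity turns the potential into n (n + 1) (mu - p^2)
    ([potential_riccati]).

    The operational identity expresses that p is the logarithmic derivative of w:
    (D - k p) (w^k z) = w^k D z = w^(k+1) ((1/w) D) z, and the powers of w
    telescope ([operational_identity]).

    For (i), let H_k = D^2 + k (k + 1) (mu - p^2), so that H_0 = D^2 and the
    equation for y_n is H_n y = lambda y.  The Riccati equation gives, for every
    constant k,
      (D + k p) (D - k p) = H_(k-1) - k^2 mu,
      (D - k p) (D + k p) = H_k - k^2 mu.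
    Hence D - k p carries the solutions of H_(k-1) y = lambda y to solutions of
    H_k y = lambda y ([darboux_solves]), and when lambda <> k^2 mu every solution
    of the latter is reached, an inverse being (lambda - k^2 mu)^-1 (D + k p)
    ([darboux_surjective]).  Composing the steps k = 0, ..., n and applying the
    operational identity shows that T maps the solutions of y'' = lambda y to
    solutions of the equation for y_n, and onto all of them when lambda differs
    from every k^2 mu.  The general solution of y'' = lambda y is
    found with the Wronskian ([fundamental_pair_general_solution]).

    For (ii), lambda = k^2 mu with k = n + 1 and the equation reads
    (D + k p) (D - k p) y = 0, which two first-order integrations solve, since
    p is the derivative of the logarithm of w ([riccati_general_solution]).

    Over the real scalars the solutions and constants found are real: D + k p
    preserves real-valuedness, and c_1, c_2 are the values of real-valued
    functions whose derivatives vanish ([constant_on_interval]). *)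

(** * Derivatives of complex-valued functions of a real variable *)

Lemma is_deriveC_iff (f : R -> C) (x : R) (l : C) :
  is_deriveC f x l <->
  is_derive (fun t => Re (f t)) x (Re l) /\ is_derive (fun t => Im (f t)) x (Im l).
Proof.
  split.
  - intros Hf; split.
    + apply (filterdiff_ext_lin _ (fun h : R => fst (scal h l : C_R_NormedModule)));
        [|reflexivity].
      apply (filterdiff_comp (V := C_R_NormedModule) f (fun z => fst z) _ (fun z => fst z) Hf).
      apply (filterdiff_linear (U := C_R_NormedModule) (fun z => fst z)).
      exact is_linear_fst.
    + apply (filterdiff_ext_lin _ (fun h : R => snd (scal h l : C_R_NormedModule)));
        [|reflexivity].
      apply (filterdiff_comp (V := C_R_NormedModule) f (fun z => snd z) _ (fun z => snd z) Hf).
      apply (filterdiff_linear (U := C_R_NormedModule) (fun z => snd z)).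
      exact is_linear_snd.
  - intros [Hr Hi].
    (* f = Re f * 1 + Im f * i *)
    apply (is_derive_ext (V := C_R_NormedModule)
      (fun t => plus (scal (Re (f t)) (RtoC 1 : C_R_NormedModule))
                     (scal (Im (f t)) (Ci : C_R_NormedModule)))).
    { intros t; destruct (f t) as [u v]; apply injective_projections;
        cbn; unfold mult; cbn; ring. }
    replace l with (plus (scal (Re l) (RtoC 1 : C_R_NormedModule))
                         (scal (Im l) (Ci : C_R_NormedModule))).
    { apply (is_derive_plus (V := C_R_NormedModule));
        apply (is_derive_scal_l (V := C_R_NormedModule)); assumption. }
    destruct l as [u v]; apply injective_projections;
      cbn; unfold mult; cbn; ring.
Qed.

Lemma D_unique (f : R -> C) (x : R) (l : C) : is_deriveC f x l -> D f x = l.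
Proof.
  intros [Hr Hi]%is_deriveC_iff; apply is_derive_unique in Hr, Hi.
  rewrite (surjective_pairing l); exact (f_equal2 pair Hr Hi).
Qed.

Lemma is_deriveC_const (c : C) (x : R) : is_deriveC (fun _ => c) x (RtoC 0).
Proof. exact (is_derive_const (V := C_R_NormedModule) c x). Qed.

Lemma is_deriveC_plus (f g : R -> C) (x : R) (df dg : C) :
  is_deriveC f x df -> is_deriveC g x dg ->
  is_deriveC (fun t => f t + g t) x (df + dg).
Proof. exact (is_derive_plus (V := C_R_NormedModule) f g x df dg). Qed.

Lemma is_deriveC_mult (f g : R -> C) (x : R) (df dg : C) :
  is_deriveC f x df -> is_deriveC g x dg ->
  is_deriveC (fun t => f t * g t) x (df * g x + f x * dg).
Proof.
  intros [Fr Fi]%is_deriveC_iff [Gr Gi]%is_deriveC_iff.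
  pose (fr := fun t => Re (f t)); pose (fi := fun t => Im (f t)).
  pose (gr := fun t => Re (g t)); pose (gi := fun t => Im (g t)).
  change (is_derive fr x (Re df)) in Fr; change (is_derive fi x (Im df)) in Fi.
  change (is_derive gr x (Re dg)) in Gr; change (is_derive gi x (Im dg)) in Gi.
  pose proof (is_derive_unique _ _ _ Fr : Derive (fun t => fr t) x = Re df) as EFr.
  pose proof (is_derive_unique _ _ _ Fi : Derive (fun t => fi t) x = Im df) as EFi.
  pose proof (is_derive_unique _ _ _ Gr : Derive (fun t => gr t) x = Re dg) as EGr.
  pose proof (is_derive_unique _ _ _ Gi : Derive (fun t => gi t) x = Im dg) as EGi.
  apply is_deriveC_iff; split.
  - change (is_derive (fun t => (fr t * gr t - fi t * gi t)%R) x
      ((Re df * gr x - Im df * gi x) + (fr x * Re dg - fi x * Im dg))%R).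
    auto_derive.
    + repeat split; eexists; eassumption.
    + rewrite EFr, EFi, EGr, EGi.
      ring.
  - change (is_derive (fun t => (fr t * gi t + fi t * gr t)%R) x
      ((Re df * gi x + Im df * gr x) + (fr x * Im dg + fi x * Re dg))%R).
    auto_derive.
    + repeat split; eexists; eassumption.
    + rewrite EFr, EFi, EGr, EGi.
      ring.
Qed.

Lemma Cnorm2_pos (z : C) : z <> 0 -> (0 < Re z * Re z + Im z * Im z)%R.
Proof.
  intros Hz.
  destruct (Req_dec (Re z) 0) as [Hr|Hr].
  - destruct (Req_dec (Im z) 0) as [Hi|Hi].
    + exfalso; apply Hz, injective_projections; assumption.
    + rewrite Hr; generalize (Rsqr_pos_lt _ Hi); unfold Rsqr; lra.
  - generalize (Rsqr_pos_lt _ Hr) (Rle_0_sqr (Im z)); unfold Rsqr; lra.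
Qed.

Lemma is_deriveC_inv (f : R -> C) (x : R) (df : C) :
  f x <> 0 -> is_deriveC f x df ->
  is_deriveC (fun t => / f t) x (- (df * (/ f x * / f x))).
Proof.
  intros Hx [Fr Fi]%is_deriveC_iff.
  apply Cnorm2_pos in Hx.
  pose (fr := fun t => Re (f t)); pose (fi := fun t => Im (f t)).
  change (is_derive fr x (Re df)) in Fr; change (is_derive fi x (Im df)) in Fi.
  change (0 < fr x * fr x + fi x * fi x)%R in Hx.
  pose proof (is_derive_unique _ _ _ Fr : Derive (fun t => fr t) x = Re df) as EFr.
  pose proof (is_derive_unique _ _ _ Fi : Derive (fun t => fi t) x = Im df) as EFi.
  apply is_deriveC_iff; split.
  - apply (is_derive_ext (fun t => (fr t / (fr t * fr t + fi t * fi t))%R)).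
    { intros t; cbn; unfold fr, fi, Re, Im; f_equal; ring. }
    auto_derive.
    + repeat split; try (eexists; eassumption); lra.
    + rewrite EFr, EFi.
      unfold fr, fi, Re, Im in *; cbn; field; lra.
  - apply (is_derive_ext (fun t => (- fi t / (fr t * fr t + fi t * fi t))%R)).
    { intros t; cbn; unfold fr, fi, Re, Im; f_equal; ring. }
    auto_derive.
    + repeat split; try (eexists; eassumption); lra.
    + rewrite EFr, EFi.
      unfold fr, fi, Re, Im in *; cbn; field; lra.
Qed.

Lemma is_deriveC_scal (c : C) (f : R -> C) (x : R) (df : C) :
  is_deriveC f x df -> is_deriveC (fun t => c * f t) x (c * df).
Proof.
  intros Hf.
  replace (c * df) with (0 * f x + c * df) by ring.
  exact (is_deriveC_mult _ _ _ _ _ (is_deriveC_const c x) Hf).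
Qed.

Lemma is_deriveC_minus (f g : R -> C) (x : R) (df dg : C) :
  is_deriveC f x df -> is_deriveC g x dg ->
  is_deriveC (fun t => f t - g t) x (df - dg).
Proof. exact (is_derive_minus (V := C_R_NormedModule) f g x df dg). Qed.

(** * Differentiability and smoothness on an open set *)

Definition smooth_on (I : R -> Prop) (f : R -> C) : Prop :=
  forall k, differentiable_on k I f.

Section OpenSet.

Context (I : R -> Prop) (HI : open I).

Lemma is_deriveC_ext_on (f g : R -> C) (x : R) (l : C) :
  (forall t, I t -> f t = g t) -> I x -> is_deriveC f x l -> is_deriveC g x l.
Proof.
  intros E Hx; apply (is_derive_ext_loc (V := C_R_NormedModule)).
  exact (filter_imp _ _ E (HI x Hx)).
Qed.

Lemma D_ext_on (f g : R -> C) :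
  (forall t, I t -> f t = g t) -> forall x, I x -> D f x = D g x.
Proof.
  intros E x Hx; unfold D; f_equal; apply Derive_ext_loc;
    apply (filter_imp I); auto; intros t Ht; rewrite (E t Ht); reflexivity.
Qed.

Lemma differentiable_on_ext (k : nat) (f g : R -> C) :
  (forall t, I t -> f t = g t) -> differentiable_on k I f -> differentiable_on k I g.
Proof.
  revert f g; induction k as [|k IH]; intros f g E; [easy|].
  intros [H1 H2]; split.
  - intros x Hx; destruct (H1 x Hx) as [d Hd].
    exists d; exact (is_deriveC_ext_on f g x d E Hx Hd).
  - exact (IH _ _ (D_ext_on f g E) H2).
Qed.

Lemma differentiable_on_le (j k : nat) (f : R -> C) :
  (j <= k)%nat -> differentiable_on k I f -> differentiable_on j I f.
Proof.
  revert k f; induction j as [|j IH]; intros k f Hjk Hf; [easy|].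
  destruct k as [|k]; [lia|].
  destruct Hf as [H1 H2]; split; [easy|].
  apply (IH k); [lia|easy].
Qed.

Lemma differentiable_on_is_deriveC (k : nat) (f : R -> C) (x : R) :
  differentiable_on (S k) I f -> I x -> is_deriveC f x (D f x).
Proof. intros [H _] Hx; apply D_correct, H, Hx. Qed.

(** With an explicit derivative at hand, the closure properties follow by
    induction on the order. *)
Lemma differentiable_on_S (k : nat) (f df : R -> C) :
  (forall x, I x -> is_deriveC f x (df x)) -> differentiable_on k I df ->
  differentiable_on (S k) I f.
Proof.
  intros H1 H2; split.
  - intros x Hx; exists (df x); exact (H1 x Hx).
  - apply (differentiable_on_ext k df); [|easy].
    intros t Ht; symmetry; exact (D_unique _ _ _ (H1 t Ht)).
Qed.

Lemma differentiable_on_const (k : nat) (c : C) : differentiable_on k I (fun _ => c).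
Proof.
  revert c; induction k as [|k IH]; intros c; [easy|].
  apply (differentiable_on_S k _ (fun _ => 0)); [|apply IH].
  intros x _; apply is_deriveC_const.
Qed.

Lemma differentiable_on_plus (k : nat) (f g : R -> C) :
  differentiable_on k I f -> differentiable_on k I g ->
  differentiable_on k I (fun t => f t + g t).
Proof.
  revert f g; induction k as [|k IH]; intros f g Hf Hg; [easy|].
  apply (differentiable_on_S k _ (fun t => D f t + D g t)).
  - intros x Hx; apply is_deriveC_plus; eapply differentiable_on_is_deriveC; eauto.
  - apply IH; [apply Hf|apply Hg].
Qed.

Lemma differentiable_on_mult (k : nat) (f g : R -> C) :
  differentiable_on k I f -> differentiable_on k I g ->
  differentiable_on k I (fun t => f t * g t).
Proof.
  revert f g; induction k as [|k IH]; intros f g Hf Hg; [easy|].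
  apply (differentiable_on_S k _ (fun t => D f t * g t + f t * D g t)).
  - intros x Hx; apply is_deriveC_mult; eapply differentiable_on_is_deriveC; eauto.
  - apply differentiable_on_plus; apply IH; try apply Hf; try apply Hg;
      apply (differentiable_on_le k (S k)); auto.
Qed.

Lemma differentiable_on_minus (k : nat) (f g : R -> C) :
  differentiable_on k I f -> differentiable_on k I g ->
  differentiable_on k I (fun t => f t - g t).
Proof.
  intros Hf Hg.
  apply (differentiable_on_ext k (fun t => f t + (- (1)) * g t)).
  { intros t _; ring. }
  apply differentiable_on_plus; [easy|].
  apply differentiable_on_mult; [apply differentiable_on_const|easy].
Qed.

Lemma differentiable_on_inv (k : nat) (f : R -> C) :
  (forall x, I x -> f x <> 0) ->
  differentiable_on k I f -> differentiable_on k I (fun t => / f t).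
Proof.
  intros Hnz; induction k as [|k IH]; intros Hf; [easy|].
  assert (Hk : differentiable_on k I (fun t => / f t)).
  { apply IH, (differentiable_on_le k (S k)); auto. }
  apply (differentiable_on_S k _ (fun t => 0 - D f t * (/ f t * / f t))).
  - intros x Hx.
    replace (0 - D f x * (/ f x * / f x)) with (- (D f x * (/ f x * / f x))) by ring.
    apply is_deriveC_inv; [auto|].
    eapply differentiable_on_is_deriveC; eauto.
  - apply differentiable_on_minus; [apply differentiable_on_const|].
    apply differentiable_on_mult; [apply Hf|].
    apply differentiable_on_mult; exact Hk.
Qed.

Lemma differentiable_on_pow (k n : nat) (f : R -> C) :
  differentiable_on k I f -> differentiable_on k I (fun t => f t ^ n).
Proof.
  intros Hf; induction n as [|n IH].
  - exact (differentiable_on_const k (RtoC 1)).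
  - exact (differentiable_on_mult k f (fun t => f t ^ n) Hf IH).
Qed.

Lemma compose_down_ext (L : nat -> operator) (n : nat) (f g : R -> C) :
  (forall k u v, (forall t, I t -> u t = v t) -> forall t, I t -> L k u t = L k v t) ->
  (forall t, I t -> f t = g t) ->
  forall t, I t -> compose_down L n f t = compose_down L n g t.
Proof.
  intros HL E; induction n as [|n IH]; cbn; apply HL; assumption.
Qed.

Lemma solves_ext (E E' : operator) (f g : R -> C) :
  (forall x, I x -> E f x = 0 -> E' g x = 0) ->
  (forall t, I t -> f t = g t) -> solves I E f -> solves I E' g.
Proof.
  intros HE Hfg [H1 H2]; split.
  - exact (differentiable_on_ext 2 f g Hfg H1).
  - intros x Hx; exact (HE x Hx (H2 x Hx)).
Qed.

End OpenSet.

(** * Scalar-valued functions *)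

Lemma is_scalar_RtoC (K : scalars) (r : R) : is_scalar K r.
Proof. destruct K; easy. Qed.

Lemma is_scalar_plus (K : scalars) (z1 z2 : C) :
  is_scalar K z1 -> is_scalar K z2 -> is_scalar K (z1 + z2).
Proof. destruct K; cbn; [|easy]. unfold Im; intros -> ->; ring. Qed.

Lemma is_scalar_opp (K : scalars) (z : C) : is_scalar K z -> is_scalar K (- z).
Proof. destruct K; cbn; [|easy]. unfold Im; intros ->; ring. Qed.

Lemma is_scalar_minus (K : scalars) (z1 z2 : C) :
  is_scalar K z1 -> is_scalar K z2 -> is_scalar K (z1 - z2).
Proof. intros; apply is_scalar_plus, is_scalar_opp; assumption. Qed.

Lemma is_scalar_mult (K : scalars) (z1 z2 : C) :
  is_scalar K z1 -> is_scalar K z2 -> is_scalar K (z1 * z2).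
Proof. destruct K; cbn; [|easy]. unfold Im; intros -> ->; ring. Qed.

Lemma is_scalar_inv (K : scalars) (z : C) : is_scalar K z -> is_scalar K (/ z).
Proof.
  destruct K; cbn; [|easy].
  unfold Im; intros ->; unfold Rdiv; ring.
Qed.

Lemma is_scalar_pow (K : scalars) (z : C) (n : nat) :
  is_scalar K z -> is_scalar K (z ^ n).
Proof.
  intros Hz; induction n as [|n IH].
  - exact (is_scalar_RtoC K 1).
  - exact (is_scalar_mult K z _ Hz IH).
Qed.

Lemma is_scalar_cexp (K : scalars) (z : C) : is_scalar K z -> is_scalar K (cexp z).
Proof. destruct K; cbn; [|easy]. intros ->; rewrite sin_0; ring. Qed.

Lemma is_scalar_ccosh (K : scalars) (z : C) : is_scalar K z -> is_scalar K (ccosh z).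
Proof.
  intros Hz; apply is_scalar_mult; [|apply is_scalar_inv, is_scalar_RtoC].
  apply is_scalar_plus; apply is_scalar_cexp; [|apply is_scalar_opp]; exact Hz.
Qed.

Lemma is_scalar_csinh (K : scalars) (z : C) : is_scalar K z -> is_scalar K (csinh z).
Proof.
  intros Hz; apply is_scalar_mult; [|apply is_scalar_inv, is_scalar_RtoC].
  apply is_scalar_minus; apply is_scalar_cexp; [|apply is_scalar_opp]; exact Hz.
Qed.

Create HintDb scalar.
#[local] Hint Resolve is_scalar_RtoC is_scalar_plus is_scalar_opp is_scalar_minus
  is_scalar_mult is_scalar_inv is_scalar_pow is_scalar_cexp is_scalar_ccosh
  is_scalar_csinh : scalar.

(** A real-valued function has vanishing imaginary part near every point of an
    open set, hence a real derivative there. *)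
Lemma is_scalar_D (K : scalars) (I : R -> Prop) (y : R -> C) :
  open I -> (forall x, I x -> is_scalar K (y x)) ->
  forall x, I x -> is_scalar K (D y x).
Proof.
  destruct K; cbn; [|easy]; intros HI Hy x Hx.
  rewrite (Derive_ext_loc _ (fun _ => 0%R)).
  - apply Derive_const.
  - exact (filter_imp _ _ Hy (HI x Hx)).
Qed.

(** * Constants and antiderivatives on an interval *)

Lemma open_open_interval (l u : Rbar) : open (open_interval l u).
Proof. apply open_and; [apply open_Rbar_gt|apply open_Rbar_lt]. Qed.

Lemma open_interval_convex (l u : Rbar) (x y t : R) :
  open_interval l u x -> open_interval l u y -> (x <= t <= y)%R ->
  open_interval l u t.
Proof.
  intros [H1 _] [_ H2] [H3 H4]; split.
  - exact (Rbar_lt_le_trans l x t H1 H3).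
  - exact (Rbar_le_lt_trans t y u H4 H2).
Qed.

(** The constant is a value of [g], which is why it is real when [g] is; on an
    empty interval 0 serves. *)
Lemma constant_on_interval (K : scalars) (l u : Rbar) (g : R -> C) :
  let I := open_interval l u in
  (forall x, I x -> is_deriveC g x (RtoC 0)) ->
  (forall x, I x -> is_scalar K (g x)) ->
  exists c, is_scalar K c /\ forall x, I x -> g x = c.
Proof.
  intros I Hd Hs.
  destruct (classic (exists x0, I x0)) as [[x0 H0]|Hno].
  2: { exists (RtoC 0); split; [apply is_scalar_RtoC|].
       intros x Hx; exfalso; eauto. }
  exists (g x0); split; [auto|].
  assert (Hlt : forall x y, I x -> I y -> (x < y)%R -> g x = g y).
  { intros x y Hx Hy Hxy.
    apply (eq_is_derive (V := C_R_NormedModule)); [|exact Hxy].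
    intros t Ht; apply Hd, (open_interval_convex l u x y t Hx Hy Ht). }
  intros x Hx; destruct (Rtotal_order x x0) as [H|[->|H]]; auto.
  symmetry; auto.
Qed.

(** Integrating the two components separately makes the imaginary part of the
    antiderivative vanish when that of [f] does. *)
Lemma antiderivative_exists (K : scalars) (l u : Rbar) (f : R -> C) :
  let I := open_interval l u in
  (forall x, I x -> ex_deriveC f x) -> (forall x, I x -> is_scalar K (f x)) ->
  exists F, antiderivative K I f F.
Proof.
  intros I Hd Hs.
  destruct (classic (exists x0, I x0)) as [[x0 H0]|Hno].
  2: { exists (fun _ => RtoC 0); intros x Hx; exfalso; eauto. }
  assert (Hbetween : forall x t, I x -> (Rmin x0 x <= t <= Rmax x0 x)%R -> I t).
  { intros x t Hx; unfold Rmin, Rmax; destruct Rle_dec; intros Ht.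
    - exact (open_interval_convex l u x0 x t H0 Hx Ht).
    - exact (open_interval_convex l u x x0 t Hx H0 Ht). }
  assert (Hc : forall g : R -> R, (forall x, I x -> ex_derive g x) ->
    forall x, I x -> is_derive (fun t => (RInt g x0 t : R)) x (g x)).
  { intros g Hg x Hx.
    apply (is_derive_RInt (V := R_NormedModule) g (fun t => RInt g x0 t) x0 x).
    - apply (filter_imp I).
      + intros t Ht; apply (RInt_correct (V := R_CompleteNormedModule)), ex_RInt_continuous.
        intros z Hz; apply (ex_derive_continuous g), Hg, (Hbetween t); assumption.
      + apply open_open_interval, Hx.
    - apply (ex_derive_continuous g), Hg, Hx. }
  assert (Hd' : forall x, I x ->
    ex_derive (fun t => Re (f t)) x /\ ex_derive (fun t => Im (f t)) x).
  { intros x Hx; destruct (Hd x Hx) as [d Hfd]; apply is_deriveC_iff in Hfd.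
    split; eexists; apply Hfd. }
  exists (fun x => (RInt (fun t => Re (f t)) x0 x, RInt (fun t => Im (f t)) x0 x)).
  intros x Hx; split.
  - destruct K; [|easy].
    change (RInt (fun t => Im (f t)) x0 x = 0%R).
    rewrite (RInt_ext _ (fun _ => 0%R)).
    + rewrite RInt_const; apply Rmult_0_r.
    + intros t Ht; apply Hs, (Hbetween x); [exact Hx|lra].
  - apply is_deriveC_iff; split.
    + apply (Hc (fun t => Re (f t))); [|exact Hx]; intros; apply Hd'; assumption.
    + apply (Hc (fun t => Im (f t))); [|exact Hx]; intros; apply Hd'; assumption.
Qed.

(** * The operational identity *)

(** Stated for the logarithmic derivative [p] of [f], which avoids the exponent
    [n - 1]. *)
Lemma is_deriveC_pow (f : R -> C) (x : R) (p : C) (n : nat) :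
  is_deriveC f x (p * f x) ->
  is_deriveC (fun t => f t ^ n) x (INR n * p * f x ^ n).
Proof.
  intros Hf; induction n as [|n IH].
  - replace (INR 0 * p * f x ^ 0) with (RtoC 0) by (cbn; ring).
    exact (is_deriveC_const 1 x).
  - replace (INR (S n) * p * f x ^ S n)
      with (p * f x * f x ^ n + f x * (INR n * p * f x ^ n))
      by (rewrite S_INR, RtoC_plus, Cpow_S; ring).
    exact (is_deriveC_mult f (fun t => f t ^ n) x _ _ Hf IH).
Qed.

Lemma differentiable_on_iter_scaled_D (I : R -> Prop) (f y : R -> C) (j k : nat) :
  open I -> smooth_on I f -> differentiable_on (j + k) I y ->
  differentiable_on k I (Nat.iter j (scaled_D f) y).
Proof.
  intros HI Hf; revert k; induction j as [|j IH]; intros k Hy; [exact Hy|].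
  apply (differentiable_on_mult I HI); [apply Hf|].
  apply (IH (S k)); rewrite Nat.add_succ_r; exact Hy.
Qed.

(** With z the (n+1)-st iterate of (1/w) D applied to y, the induction
    hypothesis reads L_n ... L_0 y = w^(n+1) z; the derivative of w^(n+1) is
    (n+1) p w^(n+1), which is exactly the term that the next factor subtracts. *)
Lemma operational_identity (I : R -> Prop) (w p : R -> C) (L : nat -> operator)
    (n : nat) (y : R -> C) :
  open I -> smooth_on I w -> (forall x, I x -> w x <> 0) ->
  (forall x, I x -> is_deriveC w x (p x * w x)) ->
  (forall k z x, L k z x = D_minus (fun t => INR k * p t) z x) ->
  differentiable_on (n + 1) I y ->
  forall x, I x ->
    compose_down L n y x =
    w x ^ (n + 1) * Nat.iter (n + 1) (scaled_D (fun t => 1 / w t)) y x.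
Proof.
  intros HI Hw Hnz Hdw HL.
  assert (Hinv : smooth_on I (fun t => 1 / w t)).
  { intros k; apply (differentiable_on_mult I HI).
    - apply (differentiable_on_const I HI k (RtoC 1)).
    - apply (differentiable_on_inv I HI); auto. }
  induction n as [|n IH]; intros Hy x Hx.
  - cbn; rewrite HL; unfold D_minus, scaled_D; cbn; field; auto.
  - cbn [compose_down]; rewrite HL; unfold D_minus.
    assert (Hn : differentiable_on (n + 1) I y)
      by (apply (differentiable_on_le I (n + 1) (S n + 1)); [lia|exact Hy]).
    pose (z := Nat.iter (n + 1) (scaled_D (fun t => 1 / w t)) y).
    assert (Hz : is_deriveC z x (D z x)).
    { apply (differentiable_on_is_deriveC I 0); [|exact Hx].
      apply differentiable_on_iter_scaled_D; auto.
      replace (n + 1 + 1)%nat with (S n + 1)%nat by lia; exact Hy. }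
    assert (HD : D (compose_down L n y) x =
      INR (n + 1) * p x * w x ^ (n + 1) * z x + w x ^ (n + 1) * D z x).
    { rewrite (D_ext_on I HI _ _ (IH Hn) x Hx).
      apply (D_unique (fun t => w t ^ (n + 1) * z t)).
      apply is_deriveC_mult; [apply is_deriveC_pow; auto|exact Hz]. }
    rewrite HD, (IH Hn x Hx).
    change (Nat.iter (S n + 1) (scaled_D (fun t => 1 / w t)) y x)
      with (1 / w x * D z x); fold z.
    replace (w x ^ (S n + 1)) with (w x * w x ^ (n + 1)) by reflexivity.
    rewrite (Nat.add_1_r n); field; auto.
Qed.

(** * Darboux transformations *)

(** Separates the derivative produced by the differentiation rules from its
    simplified form. *)
Lemma is_deriveC_eq (f : R -> C) (x : R) (l l' : C) :
  is_deriveC f x l -> l = l' -> is_deriveC f x l'.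
Proof. intros H <-; exact H. Qed.

(** The equation of the logarithmic derivative p = g'/g of a solution of
    g'' = mu g. *)
Definition riccati (I : R -> Prop) (mu : C) (p : R -> C) : Prop :=
  forall x, I x -> is_deriveC p x (mu - p x * p x).

(** The rules are selected by syntactic matching, because unification up to
    conversion may unfold the operations on pairs and take any complex-valued
    function for a sum or a difference. *)
Ltac derive :=
  lazymatch goal with
  | |- is_derive (fun _ => ?c) _ _ => exact (is_deriveC_const c _)
  | |- is_derive (fun t => Cminus (@?f t) (@?g t)) _ _ =>
      refine (is_deriveC_minus f g _ _ _ _ _); derive
  | |- is_derive (fun t => Cplus (@?f t) (@?g t)) _ _ =>
      refine (is_deriveC_plus f g _ _ _ _ _); derive
  | |- is_derive (fun t => Cmult (@?f t) (@?g t)) _ _ =>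
      refine (is_deriveC_mult f g _ _ _ _ _); derive
  | H : forall x, _ -> is_derive ?f x _ |- is_derive ?f _ _ => apply H; assumption
  | H : forall x, _ -> is_derive ?f x _ |- is_derive (fun t => ?f t) _ _ =>
      apply H; assumption
  | H : riccati _ _ ?p |- is_derive ?p _ _ => apply H; assumption
  | H : riccati _ _ ?p |- is_derive (fun t => ?p t) _ _ => apply H; assumption
  end.

Definition schrodinger (lambda : C) (V : R -> C) : operator :=
  fun y x => D (D y) x - (lambda - V x) * y x.

Lemma differentiable_on_2 (I : R -> Prop) (u u1 u2 : R -> C) :
  open I ->
  (forall x, I x -> is_deriveC u x (u1 x)) ->
  (forall x, I x -> is_deriveC u1 x (u2 x)) ->
  differentiable_on 2 I u /\ forall x, I x -> D (D u) x = u2 x.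
Proof.
  intros HI H1 H2; split.
  - apply (differentiable_on_S I HI 1 u u1 H1).
    exact (differentiable_on_S I HI 0 u1 u2 H2 Logic.I).
  - intros x Hx; apply D_unique.
    apply (is_deriveC_ext_on I HI u1); auto.
    intros t Ht; symmetry; apply D_unique, H1, Ht.
Qed.

(** The derivative of [p] is a polynomial in [p], so each order of
    differentiability gives the next. *)
Lemma riccati_smooth (I : R -> Prop) (mu : C) (p : R -> C) :
  open I -> riccati I mu p -> smooth_on I p.
Proof.
  intros HI Hp k; induction k as [|k IH]; [easy|].
  apply (differentiable_on_S I HI k p _ Hp).
  apply (differentiable_on_minus I HI); [apply (differentiable_on_const I HI)|].
  apply (differentiable_on_mult I HI); exact IH.
Qed.

(** The equation itself expresses the second derivative through the solution,
    so a solution of an equation with smooth potential gains two orders of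
    differentiability at a time. *)
Lemma schrodinger_smooth (I : R -> Prop) (lambda : C) (V y : R -> C) :
  open I -> smooth_on I V -> solves I (schrodinger lambda V) y -> smooth_on I y.
Proof.
  intros HI HV [Hy E].
  assert (H : forall k, differentiable_on k I y /\ differentiable_on (S k) I y).
  { induction k as [|k [IH1 IH2]].
    - split; [easy|apply (differentiable_on_le I 1 2); auto].
    - split; [exact IH2|].
      split; [apply Hy|split; [apply Hy|]].
      apply (differentiable_on_ext I HI k (fun t => (lambda - V t) * y t)).
      + intros t Ht; rewrite <- (Cplus_0_r (_ * _)), <- (E t Ht).
        unfold schrodinger; ring.
      + apply (differentiable_on_mult I HI); [|exact IH1].
        apply (differentiable_on_minus I HI); [|apply HV].
        apply (differentiable_on_const I HI). }
  intros k; apply H.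
Qed.

Lemma schrodinger_ext (I : R -> Prop) (lambda : C) (V V' y z : R -> C) :
  open I -> (forall x, I x -> V x = V' x) -> (forall x, I x -> y x = z x) ->
  solves I (schrodinger lambda V) y -> solves I (schrodinger lambda V') z.
Proof.
  intros HI HV Hyz; apply (solves_ext I HI); [|exact Hyz].
  intros x Hx H; rewrite <- H; unfold schrodinger.
  rewrite (HV x Hx), (Hyz x Hx); f_equal.
  apply (D_ext_on I HI); [|exact Hx]; apply (D_ext_on I HI).
  intros t Ht; symmetry; exact (Hyz t Ht).
Qed.

Lemma schrodinger_scal (I : R -> Prop) (lambda c : C) (V y : R -> C) :
  open I -> solves I (schrodinger lambda V) y ->
  solves I (schrodinger lambda V) (fun x => c * y x).
Proof.
  intros HI [Hy E].
  destruct (differentiable_on_2 I (fun x => c * y x) (fun x => c * D y x)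
              (fun x => c * D (D y) x) HI) as [H2 HD].
  - intros x Hx; apply is_deriveC_scal, D_correct, Hy, Hx.
  - intros x Hx; apply is_deriveC_scal, D_correct, Hy, Hx.
  - split; [exact H2|].
    intros x Hx; unfold schrodinger; rewrite HD by exact Hx.
    rewrite <- (Cmult_0_r c), <- (E x Hx); unfold schrodinger; ring.
Qed.

(** The cross terms - k p y' cancel, and k p' + k^2 p^2 =
    k^2 mu - k (k - 1) (mu - p^2) by the Riccati equation. *)
Lemma darboux_factorization (I : R -> Prop) (mu kappa : C) (p y : R -> C) :
  open I -> riccati I mu p -> differentiable_on 2 I y ->
  forall x, I x ->
    D_plus (fun t => kappa * p t) (D_minus (fun t => kappa * p t) y) x =
    schrodinger (kappa ^ 2 * mu)
      (fun t => kappa * (kappa - 1) * (mu - p t * p t)) y x.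
Proof.
  intros HI Hp Hy x Hx; unfold D_plus.
  assert (H0 : forall x, I x -> is_deriveC y x (D y x))
    by (intros; apply D_correct, Hy; assumption).
  assert (Hd : is_deriveC (D_minus (fun t => kappa * p t) y) x
    (D (D y) x - (kappa * (mu - p x * p x) * y x + kappa * p x * D y x))).
  { unfold D_minus.
    apply is_deriveC_minus; [apply D_correct, Hy, Hx|].
    eapply is_deriveC_eq; [derive|cbv beta; ring]. }
  rewrite (D_unique _ _ _ Hd); unfold D_minus, schrodinger; ring.
Qed.

(** Here kappa is any complex constant.  Replacing kappa by - kappa exchanges the
    two potentials kappa (kappa - 1) (mu - p^2) and kappa (kappa + 1) (mu - p^2),
    so the same lemma covers D - kappa p and its companion D + kappa p, which goes
    back. *)
Lemma darboux_solves (I : R -> Prop) (lambda mu kappa : C) (p y : R -> C) :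
  open I -> riccati I mu p ->
  solves I
    (schrodinger lambda (fun x => kappa * (kappa - 1) * (mu - p x * p x))) y ->
  solves I
    (schrodinger lambda (fun x => kappa * (kappa + 1) * (mu - p x * p x)))
    (D_minus (fun t => kappa * p t) y).
Proof.
  intros HI Hp [Hy E].
  assert (H0 : forall x, I x -> is_deriveC y x (D y x))
    by (intros x Hx; apply D_correct, Hy, Hx).
  assert (H1 : forall x, I x -> is_deriveC (D y) x
    ((lambda - kappa * (kappa - 1) * (mu - p x * p x)) * y x)).
  { intros x Hx; apply (is_deriveC_eq _ _ (D (D y) x)).
    - apply D_correct, Hy, Hx.
    - rewrite <- (Cplus_0_r (_ * y x)), <- (E x Hx); unfold schrodinger; ring. }
  destruct (differentiable_on_2 I (D_minus (fun t => kappa * p t) y)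
    (fun x => (lambda - kappa * kappa * (mu - p x * p x)) * y x
              - kappa * p x * D y x)
    (fun x => (lambda - kappa * (kappa + 1) * (mu - p x * p x))
              * (D y x - kappa * p x * y x)) HI) as [H2 HD].
  - intros x Hx; unfold D_minus; eapply is_deriveC_eq; [derive|cbv beta; ring].
  - intros x Hx; eapply is_deriveC_eq; [derive|cbv beta; ring].
  - split; [exact H2|].
    intros x Hx; unfold schrodinger; rewrite HD by exact Hx.
    unfold D_minus; ring.
Qed.

(** On solutions for the potential kappa (kappa + 1) (mu - p^2), the product
    (D - kappa p) (D + kappa p) is multiplication by lambda - kappa^2 mu, by
    [darboux_factorization] for - kappa.  So a preimage of u is D + kappa p
    applied to c u with c = 1 / (lambda - kappa^2 mu). *)
Lemma darboux_surjective (K : scalars) (I : R -> Prop) (lambda mu kappa : C)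
    (p u : R -> C) :
  open I -> riccati I mu p ->
  is_scalar K lambda -> is_scalar K mu -> is_scalar K kappa ->
  (forall x, I x -> is_scalar K (p x)) ->
  lambda <> kappa ^ 2 * mu ->
  (forall x, I x -> is_scalar K (u x)) ->
  solves I
    (schrodinger lambda (fun x => kappa * (kappa + 1) * (mu - p x * p x))) u ->
  exists v,
    (forall x, I x -> is_scalar K (v x)) /\
    solves I
      (schrodinger lambda (fun x => kappa * (kappa - 1) * (mu - p x * p x))) v /\
    forall x, I x -> D_minus (fun t => kappa * p t) v x = u x.
Proof.
  intros HI Hp Kl Km Kk Kp Hne Ku Hu.
  set (c := / (lambda - kappa ^ 2 * mu)).
  assert (Kc : is_scalar K c) by (unfold c; auto 6 with scalar).
  assert (Hcu : solves I (schrodinger lambda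
    (fun x => - kappa * (- kappa - 1) * (mu - p x * p x))) (fun x => c * u x)).
  { apply (schrodinger_ext I lambda
      (fun x => kappa * (kappa + 1) * (mu - p x * p x)) _ (fun x => c * u x) _ HI);
      [intros; ring|easy|apply schrodinger_scal; assumption]. }
  exists (D_minus (fun t => - kappa * p t) (fun x => c * u x)).
  split; [|split].
  - intros x Hx; apply is_scalar_minus; [|auto 6 with scalar].
    apply (is_scalar_D K I); auto with scalar.
  - apply (schrodinger_ext I lambda
      (fun x => - kappa * (- kappa + 1) * (mu - p x * p x)) _
      (D_minus (fun t => - kappa * p t) (fun x => c * u x)) _ HI);
      [intros; ring|easy|apply darboux_solves; assumption].
  - intros x Hx; destruct Hcu as [Hcu E].
    pose proof (darboux_factorization I mu (- kappa) p _ HI Hp Hcu x Hx) as HF.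
    specialize (E x Hx); unfold schrodinger in E.
    transitivity (D_plus (fun t => - kappa * p t)
      (D_minus (fun t => - kappa * p t) (fun x => c * u x)) x);
      [unfold D_minus at 1, D_plus; ring|].
    rewrite HF; unfold schrodinger; clear HF.
    transitivity ((lambda - kappa ^ 2 * mu) * (c * u x)).
    + rewrite <- (Cplus_0_r (_ * (c * _))), <- E; ring.
    + unfold c; field; intros H; apply Hne, Ceq_minus, H.
Qed.

(** The potential reached by the step of index k is the one from which the step of
    index k + 1 starts: k (k + 1) = (k + 1) ((k + 1) - 1).  The step of index 0 is
    D, which maps solutions for the zero potential to such solutions. *)
Lemma darboux_chain_solves (I : R -> Prop) (lambda mu : C) (p y : R -> C)
    (L : nat -> operator) (n : nat) :
  open I -> riccati I mu p ->
  (forall k z x, L k z x = D_minus (fun t => INR k * p t) z x) ->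
  solves I (schrodinger lambda (fun _ => 0)) y ->
  solves I
    (schrodinger lambda (fun x => INR n * (INR n + 1) * (mu - p x * p x)))
    (compose_down L n y).
Proof.
  intros HI Hp HL Hy.
  set (E k := schrodinger lambda
    (fun x => INR k * (INR k - 1) * (mu - p x * p x))).
  assert (Hstep : forall k z, solves I (E k) z -> solves I (schrodinger lambda
    (fun x => INR k * (INR k + 1) * (mu - p x * p x))) (L k z)).
  { intros k z Hz.
    apply (schrodinger_ext I lambda
      (fun x => INR k * (INR k + 1) * (mu - p x * p x)) _
      (D_minus (fun t => INR k * p t) z) _ HI); auto.
    apply darboux_solves; assumption. }
  induction n as [|n IH]; cbn [compose_down]; apply Hstep.
  - revert Hy; apply (solves_ext I HI); [|easy].
    intros x _ <-; unfold E, schrodinger; cbv beta; change (RtoC (INR 0)) with (RtoC 0); ring.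
  - revert IH; apply (solves_ext I HI); [|easy].
    intros x _ <-; unfold E, schrodinger; rewrite S_INR, RtoC_plus; ring.
Qed.

(** The preimages are taken from the last step down to the step of index 0; the
    latter inverts D, whence the condition lambda <> 0, included as k = 0. *)
Lemma darboux_chain_surjective (K : scalars) (I : R -> Prop) (lambda mu : C)
    (p u : R -> C) (L : nat -> operator) (n : nat) :
  open I -> riccati I mu p ->
  (forall k z x, L k z x = D_minus (fun t => INR k * p t) z x) ->
  is_scalar K lambda -> is_scalar K mu ->
  (forall x, I x -> is_scalar K (p x)) ->
  (forall k, (k <= n)%nat -> lambda <> INR k ^ 2 * mu) ->
  (forall x, I x -> is_scalar K (u x)) ->
  solves I
    (schrodinger lambda (fun x => INR n * (INR n + 1) * (mu - p x * p x))) u ->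
  exists v,
    (forall x, I x -> is_scalar K (v x)) /\
    solves I (schrodinger lambda (fun _ => 0)) v /\
    forall x, I x -> compose_down L n v x = u x.
Proof.
  intros HI Hp HL Kl Km Kp; revert u; induction n as [|n IH]; intros u Hne Ku Hu.
  - destruct (darboux_surjective K I lambda mu (INR 0) p u) as (v & Kv & Hv & Huv);
      auto with scalar.
    exists v; split; [exact Kv|split].
    + revert Hv; apply (schrodinger_ext I _ _ _ _ _ HI); [|easy].
      intros x _; change (RtoC (INR 0)) with (RtoC 0); ring.
    + intros x Hx; cbn; rewrite HL; auto.
  - destruct (darboux_surjective K I lambda mu (INR (S n)) p u)
      as (v1 & Kv1 & Hv1 & Hu1); auto with scalar.
    destruct (IH v1) as (v & Kv & Hv & Huv); auto.
    + revert Hv1; apply (schrodinger_ext I _ _ _ _ _ HI); [|easy].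
      intros x _; rewrite S_INR, RtoC_plus; ring.
    + exists v; split; [exact Kv|split; [exact Hv|]].
      intros x Hx; rewrite <- (Hu1 x Hx); cbn [compose_down]; rewrite HL.
      unfold D_minus; rewrite Huv by exact Hx; f_equal.
      apply (D_ext_on I HI); auto.
Qed.

(** * The equation with constant coefficients *)

(** A basis, on the whole line, of the solutions of y'' = lambda y; W is its
    Wronskian. *)
Definition fundamental_pair (K : scalars) (lambda : C) (phi psi : R -> C) : Prop :=
  exists (dphi dpsi : R -> C) (W : C),
    (forall x, is_deriveC phi x (dphi x)) /\
    (forall x, is_deriveC dphi x (lambda * phi x)) /\
    (forall x, is_deriveC psi x (dpsi x)) /\
    (forall x, is_deriveC dpsi x (lambda * psi x)) /\
    (forall x, is_scalar K (phi x) /\ is_scalar K (dphi x)) /\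
    (forall x, is_scalar K (psi x) /\ is_scalar K (dpsi x)) /\
    (forall x, phi x * dpsi x - dphi x * psi x = W) /\ W <> 0.

Lemma fundamental_pair_solves (K : scalars) (I : R -> Prop) (lambda c1 c2 : C)
    (phi psi : R -> C) :
  open I -> fundamental_pair K lambda phi psi ->
  solves I (schrodinger lambda (fun _ => 0)) (fun x => c1 * phi x + c2 * psi x).
Proof.
  intros HI (dphi & dpsi & W & H1 & H2 & H3 & H4 & _).
  destruct (differentiable_on_2 I (fun x => c1 * phi x + c2 * psi x)
    (fun x => c1 * dphi x + c2 * dpsi x)
    (fun x => lambda * (c1 * phi x + c2 * psi x)) HI) as [Hd HD].
  - intros x _; apply is_deriveC_plus; apply is_deriveC_scal; eauto.
  - intros x _; eapply is_deriveC_eq.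
    + apply is_deriveC_plus; apply is_deriveC_scal; eauto.
    + ring.
  - split; [exact Hd|].
    intros x Hx; unfold schrodinger; rewrite HD by exact Hx; ring.
Qed.

(** By Cramer's rule the constants must be (y psi' - y' psi) / W and
    (phi y' - phi' y) / W; their derivatives vanish because y'', phi'' and psi'' are
    the same multiple of y, phi and psi. *)
Lemma fundamental_pair_general_solution (K : scalars) (l u : Rbar) (lambda : C)
    (phi psi : R -> C) :
  let I := open_interval l u in
  fundamental_pair K lambda phi psi ->
  general_solution K I (schrodinger lambda (fun _ => 0))
    (fun c1 c2 x => c1 * phi x + c2 * psi x).
Proof.
  intros I Hpair.
  assert (HI : open I) by apply open_open_interval.
  intros y Ky; split.
  - intros [Hy E].
    destruct Hpair as (dphi & dpsi & W & H1 & H2 & H3 & H4 & K1 & K2 & HW & W0).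
    assert (Hd1 : forall x, I x -> is_deriveC y x (D y x))
      by (intros; apply D_correct, Hy; assumption).
    assert (Hd2 : forall x, I x -> is_deriveC (D y) x (lambda * y x)).
    { intros x Hx; apply (is_deriveC_eq _ _ (D (D y) x)).
      - apply D_correct, Hy, Hx.
      - rewrite <- (Cplus_0_r (lambda * _)), <- (E x Hx); unfold schrodinger; ring. }
    pose proof (is_scalar_D K I y HI Ky) as KD.
    assert (KW : forall x, I x -> is_scalar K (/ W)).
    { intros x Hx; rewrite <- (HW x); destruct (K1 x), (K2 x); auto with scalar. }
    destruct (constant_on_interval K l u
      (fun x => / W * (y x * dpsi x - D y x * psi x))) as [c1 [Kc1 E1]].
    { intros x Hx; eapply is_deriveC_eq.
      - apply is_deriveC_scal, is_deriveC_minus; apply is_deriveC_mult; eauto.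
      - cbv beta; ring. }
    { intros x Hx; pose proof (KW x Hx); destruct (K1 x), (K2 x); auto 7 with scalar. }
    destruct (constant_on_interval K l u
      (fun x => / W * (phi x * D y x - dphi x * y x))) as [c2 [Kc2 E2]].
    { intros x Hx; eapply is_deriveC_eq.
      - apply is_deriveC_scal, is_deriveC_minus; apply is_deriveC_mult; eauto.
      - cbv beta; ring. }
    { intros x Hx; pose proof (KW x Hx); destruct (K1 x), (K2 x); auto 7 with scalar. }
    exists c1, c2; split; [exact Kc1|split; [exact Kc2|]].
    intros x Hx; rewrite <- (E1 x Hx), <- (E2 x Hx).
    transitivity (/ W * (phi x * dpsi x - dphi x * psi x) * y x); [|ring].
    rewrite (HW x); field; exact W0.
  - intros (c1 & c2 & _ & _ & Hc).
    apply (schrodinger_ext I lambda (fun _ => 0) _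
      (fun x => c1 * phi x + c2 * psi x) _ HI).
    + easy.
    + intros x Hx; symmetry; exact (Hc x Hx).
    + exact (fundamental_pair_solves K I lambda c1 c2 phi psi HI Hpair).
Qed.

Lemma is_deriveC_RtoC (f : R -> R) (x d : R) :
  is_derive f x d -> is_deriveC (fun t => RtoC (f t)) x (RtoC d).
Proof.
  intros Hf; apply is_deriveC_iff; split; [exact Hf|].
  exact (is_derive_const (V := R_NormedModule) 0%R x).
Qed.

Lemma is_deriveC_cexp (c : C) (x : R) :
  is_deriveC (fun t => cexp (c * t)) x (c * cexp (c * x)).
Proof.
  destruct c as [u v]; apply is_deriveC_iff; split.
  - apply (is_derive_ext (fun t => (exp (u * t) * cos (v * t))%R)).
    { intros t; cbn; f_equal; f_equal; ring. }
    auto_derive; [easy|]; cbn.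
    replace (u * x - v * 0)%R with (u * x)%R by ring.
    replace (u * 0 + v * x)%R with (v * x)%R by ring; ring.
  - apply (is_derive_ext (fun t => (exp (u * t) * sin (v * t))%R)).
    { intros t; cbn; f_equal; f_equal; ring. }
    auto_derive; [easy|]; cbn.
    replace (u * x - v * 0)%R with (u * x)%R by ring.
    replace (u * 0 + v * x)%R with (v * x)%R by ring; ring.
Qed.

Lemma is_deriveC_cexp_opp (c : C) (x : R) :
  is_deriveC (fun t => cexp (- (c * t))) x (- (c * cexp (- (c * x)))).
Proof.
  apply (is_derive_ext (V := C_R_NormedModule) (fun t => cexp (- c * t))).
  - intros t; f_equal; ring.
  - eapply is_deriveC_eq; [apply is_deriveC_cexp|].
    replace (- c * x) with (- (c * x)) by ring; ring.
Qed.

Lemma cexp_mult_opp (z : C) : cexp z * cexp (- z) = 1.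
Proof.
  destruct z as [u v]; apply injective_projections; cbn;
    rewrite cos_neg, sin_neg.
  - transitivity (exp u * exp (- u) * (cos v * cos v + sin v * sin v))%R; [ring|].
    rewrite <- exp_plus, Rplus_opp_r, exp_0.
    generalize (sin2_cos2 v); unfold Rsqr; lra.
  - ring.
Qed.

(** The Wronskians of the three forms are - 2 s, sqrt r and sqrt (- r); they are
    nonzero because lambda is. *)
Lemma y0_form_fundamental_pair (K : scalars) (lambda : C) (y0 : C -> C -> R -> C) :
  lambda <> 0 -> y0_form K lambda y0 ->
  exists phi psi, fundamental_pair K lambda phi psi /\
    y0 = fun c1 c2 x => c1 * phi x + c2 * psi x.
Proof.
  intros Hl [s Ks Hs|r Hr Hlr|r Hr Hlr].
  - exists (fun x => cexp (s * x)), (fun x => cexp (- (s * x))); split; [|easy].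
    exists (fun x => s * cexp (s * x)), (fun x => - s * cexp (- (s * x))),
      (- (2 * s)).
    rewrite <- Hs in *; split; [|split; [|split; [|split; [|split; [|split]]]]].
    + intros x; apply is_deriveC_cexp.
    + intros x; eapply is_deriveC_eq; [apply is_deriveC_scal, is_deriveC_cexp|ring].
    + intros x; eapply is_deriveC_eq; [apply is_deriveC_cexp_opp|ring].
    + intros x; eapply is_deriveC_eq;
        [apply is_deriveC_scal, is_deriveC_cexp_opp|ring].
    + intros x; auto 8 with scalar.
    + intros x; auto 8 with scalar.
    + split.
      * intros x; transitivity (- (2 * s) * (cexp (s * x) * cexp (- (s * x)))).
        -- ring.
        -- rewrite cexp_mult_opp; ring.
      * intros H; apply Hl.
        transitivity (- (2 * s) * - (s / 2)); [field|rewrite H; ring].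
  - exists (fun x => RtoC (cosh (sqrt r * x))), (fun x => RtoC (sinh (sqrt r * x))).
    split; [|easy].
    pose proof (sqrt_sqrt r (Rlt_le _ _ Hr)) as Hw; set (w := sqrt r) in *.
    exists (fun x => RtoC (w * sinh (w * x))), (fun x => RtoC (w * cosh (w * x))),
      (RtoC w).
    assert (Hch : forall x, is_derive (fun t => cosh (w * t)) x (w * sinh (w * x))%R).
    { intros x; unfold cosh, sinh; auto_derive; [easy|field]. }
    assert (Hsh : forall x, is_derive (fun t => sinh (w * t)) x (w * cosh (w * x))%R).
    { intros x; unfold cosh, sinh; auto_derive; [easy|field]. }
    rewrite Hlr; split; [|split; [|split; [|split; [|split; [|split]]]]].
    + intros x; apply is_deriveC_RtoC, Hch.
    + intros x; rewrite <- RtoC_mult, <- Hw, Rmult_assoc.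
      apply is_deriveC_RtoC, is_derive_scal, Hsh.
    + intros x; apply is_deriveC_RtoC, Hsh.
    + intros x; rewrite <- RtoC_mult, <- Hw, Rmult_assoc.
      apply is_deriveC_RtoC, is_derive_scal, Hch.
    + auto with scalar.
    + auto with scalar.
    + split.
      * intros x; rewrite <- !RtoC_mult, <- RtoC_minus; f_equal.
        transitivity (w * (exp (w * x) * exp (- (w * x))))%R.
        -- unfold cosh, sinh; field.
        -- rewrite <- exp_plus, Rplus_opp_r, exp_0; ring.
      * intros H; apply RtoC_inj in H; rewrite H in Hw; lra.
  - exists (fun x => RtoC (cos (sqrt (- r) * x))), (fun x => RtoC (sin (sqrt (- r) * x))).
    split; [|easy].
    assert (Hr' : (0 <= - r)%R) by lra.
    pose proof (sqrt_sqrt _ Hr') as Hw; set (w := sqrt (- r)) in *.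
    exists (fun x => RtoC (- w * sin (w * x))), (fun x => RtoC (w * cos (w * x))),
      (RtoC w).
    assert (Hc : forall x, is_derive (fun t => cos (w * t)) x (- w * sin (w * x))%R).
    { intros x; auto_derive; [easy|ring]. }
    assert (Hs : forall x, is_derive (fun t => sin (w * t)) x (w * cos (w * x))%R).
    { intros x; auto_derive; [easy|ring]. }
    replace r with (- w * w)%R in Hlr by lra.
    rewrite Hlr; split; [|split; [|split; [|split; [|split; [|split]]]]].
    + intros x; apply is_deriveC_RtoC, Hc.
    + intros x; rewrite <- RtoC_mult, Rmult_assoc.
      apply is_deriveC_RtoC, is_derive_scal, Hs.
    + intros x; apply is_deriveC_RtoC, Hs.
    + intros x; rewrite <- RtoC_mult, (Rmult_comm (- w)), Rmult_assoc.
      apply is_deriveC_RtoC, is_derive_scal, Hc.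
    + auto with scalar.
    + auto with scalar.
    + split.
      * intros x; rewrite <- !RtoC_mult, <- RtoC_minus; f_equal.
        generalize (sin2_cos2 (w * x)); unfold Rsqr; intros H.
        transitivity (w * (sin (w * x) * sin (w * x) + cos (w * x) * cos (w * x)))%R;
          [ring|rewrite H; ring].
      * intros H; apply RtoC_inj in H; rewrite H in Hw; lra.
Qed.

(** * The logarithmic derivative of the weight *)

Lemma is_deriveC_w (a b m : C) (x : R) :
  is_deriveC (w a b m) x (m * w_conj a b m x).
Proof.
  unfold w, w_conj, ccosh, csinh, Cdiv.
  eapply is_deriveC_eq.
  - apply is_deriveC_plus; apply is_deriveC_scal; apply is_deriveC_mult;
      [apply is_deriveC_plus|apply is_deriveC_const
      |apply is_deriveC_minus|apply is_deriveC_const];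
      [apply is_deriveC_cexp|apply is_deriveC_cexp_opp
      |apply is_deriveC_cexp|apply is_deriveC_cexp_opp].
  - cbv beta; ring.
Qed.

Lemma is_deriveC_w_conj (a b m : C) (x : R) :
  is_deriveC (w_conj a b m) x (m * w a b m x).
Proof.
  replace (m * w a b m x) with (m * w_conj b a m x)
    by (unfold w, w_conj; ring).
  apply (is_derive_ext (V := C_R_NormedModule) (w b a m)).
  - intros t; change (w b a m t = w_conj a b m t); unfold w, w_conj; ring.
  - apply is_deriveC_w.
Qed.

(** The derivatives of [w] and [w_conj] are multiples of each other, so both are
    handled by one induction. *)
Lemma w_smooth (I : R -> Prop) (a b m : C) : open I -> smooth_on I (w a b m).
Proof.
  intros HI k; cut (differentiable_on k I (w a b m) /\
                    differentiable_on k I (w_conj a b m)); [easy|].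
  induction k as [|k [IH1 IH2]]; [easy|split].
  - apply (differentiable_on_S I HI k _ (fun x => m * w_conj a b m x)).
    + intros x _; apply is_deriveC_w.
    + apply (differentiable_on_mult I HI); [apply (differentiable_on_const I HI)|easy].
  - apply (differentiable_on_S I HI k _ (fun x => m * w a b m x)).
    + intros x _; apply is_deriveC_w_conj.
    + apply (differentiable_on_mult I HI); [apply (differentiable_on_const I HI)|easy].
Qed.

Lemma w_pythagoras (a b m : C) (x : R) :
  w a b m x ^ 2 - w_conj a b m x ^ 2 = a ^ 2 - b ^ 2.
Proof.
  unfold w, w_conj, ccosh, csinh, Cdiv.
  transitivity ((a ^ 2 - b ^ 2) * (cexp (m * x) * cexp (- (m * x)))).
  - field.
  - rewrite cexp_mult_opp; ring.
Qed.

Lemma w_riccati (I : R -> Prop) (a b m : C) :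
  (forall x, I x -> w a b m x <> 0) ->
  riccati I (m ^ 2) (fun x => m * (w_conj a b m x / w a b m x)).
Proof.
  intros Hnz x Hx; unfold Cdiv; eapply is_deriveC_eq.
  - apply is_deriveC_scal, is_deriveC_mult; [apply is_deriveC_w_conj|].
    apply is_deriveC_inv; [exact (Hnz x Hx)|apply is_deriveC_w].
  - cbv beta; field; exact (Hnz x Hx).
Qed.

Lemma potential_riccati (n : nat) (a b m : C) (x : R) :
  w a b m x <> 0 ->
  let p := m * (w_conj a b m x / w a b m x) in
  potential n a b m x = INR n * (INR n + 1) * (m ^ 2 - p * p).
Proof.
  intros Hnz p; unfold potential; rewrite <- (w_pythagoras a b m x).
  unfold p; field; exact Hnz.
Qed.

(** * The exceptional eigenvalue *)

(** The equation is (D + kappa p) (D - kappa p) y = 0, and g, whose logarithmic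
    derivative is kappa p, is an integrating factor for both factors: v = (D -
    kappa p) y satisfies (g v)' = 0, so g v = c_2, and then
    (y / g)' = v / g = c_2 / g^2 = (c_2 F)'. *)
Lemma riccati_general_solution (K : scalars) (l u : Rbar) (mu kappa : C)
    (p g F : R -> C) :
  let I := open_interval l u in
  riccati I mu p ->
  is_scalar K kappa ->
  (forall x, I x -> is_scalar K (p x)) ->
  (forall x, I x -> is_scalar K (g x)) ->
  (forall x, I x -> g x <> 0) ->
  (forall x, I x -> is_deriveC g x (kappa * p x * g x)) ->
  antiderivative K I (fun x => / (g x * g x)) F ->
  general_solution K I
    (schrodinger (kappa ^ 2 * mu)
      (fun t => kappa * (kappa - 1) * (mu - p t * p t)))
    (fun c1 c2 x => g x * (c1 + c2 * F x)).
Proof.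
  intros I Hp Kk Kp Kg Hnz Hg HF.
  assert (HI : open I) by apply open_open_interval.
  assert (HdF : forall x, I x -> is_deriveC F x (/ (g x * g x))) by apply HF.
  intros y Ky; split.
  - intros [Hy E].
    assert (Hd : forall x, I x -> is_deriveC y x (D y x))
      by (intros; apply D_correct, Hy; assumption).
    pose proof (is_scalar_D K I y HI Ky) as KD.
    set (v := D_minus (fun t => kappa * p t) y).
    assert (Hv : forall x, I x -> is_deriveC v x (- (kappa * p x * v x))).
    { intros x Hx.
      assert (Hdv : is_deriveC v x (D v x)).
      { apply (differentiable_on_is_deriveC I 0 v x); [|exact Hx].
        apply (differentiable_on_minus I HI); [apply Hy|].
        repeat apply (differentiable_on_mult I HI).
        - apply (differentiable_on_const I HI).
        - exact (riccati_smooth I mu p HI Hp 1%nat).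
        - apply (differentiable_on_le I 1 2); auto. }
      apply (is_deriveC_eq _ _ _ _ Hdv).
      rewrite <- (Cplus_0_r (- _)), <- (E x Hx).
      rewrite <- (darboux_factorization I mu kappa p y HI Hp Hy x Hx).
      unfold D_plus; fold v; ring. }
    destruct (constant_on_interval K l u (fun x => g x * v x)) as [c2 [Kc2 E2]].
    { intros x Hx; eapply is_deriveC_eq; [apply is_deriveC_mult; auto|ring]. }
    { intros x Hx; unfold v, D_minus; auto 6 with scalar. }
    destruct (constant_on_interval K l u (fun x => / g x * y x - c2 * F x))
      as [c1 [Kc1 E1]].
    { intros x Hx; eapply is_deriveC_eq.
      - apply is_deriveC_minus; [|apply is_deriveC_scal, HdF, Hx].
        apply is_deriveC_mult; [apply is_deriveC_inv|]; auto.
      - cbv beta; rewrite <- (E2 x Hx); unfold v, D_minus; field; auto. }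
    { intros x Hx; assert (is_scalar K (F x)) by (apply HF, Hx).
      auto with scalar. }
    exists c1, c2; split; [exact Kc1|split; [exact Kc2|]].
    intros x Hx; rewrite <- (E1 x Hx); field; auto.
  - intros (c1 & c2 & _ & _ & Hc).
    set (z := fun x => g x * (c1 + c2 * F x)).
    (* z' = kappa p z + c2 / g; differentiating again, the multiples of c2 / g
       cancel *)
    destruct (differentiable_on_2 I z
      (fun x => kappa * p x * z x + c2 * / g x)
      (fun x => (kappa * (mu - p x * p x) + kappa ^ 2 * (p x * p x)) * z x) HI)
      as [H2 HD].
    + intros x Hx; unfold z; eapply is_deriveC_eq; [derive|].
      cbv beta; field; auto.
    + intros x Hx.
      assert (Hz : is_deriveC z x (kappa * p x * z x + c2 * / g x)).
      { unfold z; eapply is_deriveC_eq; [derive|]; cbv beta; field; auto. }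
      eapply is_deriveC_eq.
      * apply is_deriveC_plus.
        -- apply is_deriveC_mult; [apply is_deriveC_scal, Hp, Hx|exact Hz].
        -- apply is_deriveC_scal, is_deriveC_inv; auto.
      * cbv beta; field; auto.
    + apply (schrodinger_ext I (kappa ^ 2 * mu)
        (fun t => kappa * (kappa - 1) * (mu - p t * p t)) _ z _ HI).
      * easy.
      * intros x Hx; symmetry; exact (Hc x Hx).
      * split; [exact H2|]; intros x Hx.
        unfold schrodinger; rewrite HD by exact Hx; ring.
Qed.

(** * Equations with hyperbolic coefficients *)

Lemma general_solution_ext (K : scalars) (I : R -> Prop) (E E' : operator)
    (Y : C -> C -> R -> C) :
  open I -> (forall y x, I x -> E y x = E' y x) ->
  general_solution K I E Y -> general_solution K I E' Y.
Proof.
  intros HI HE HG y Ky; rewrite <- (HG y Ky); split;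
    apply (solves_ext I HI); try easy;
    intros x Hx H; [rewrite HE|rewrite <- HE]; assumption.
Qed.

Theorem mainTheorem4 :
  forall (K : scalars) (n : nat) (a b m : C) (l u : Rbar),
    (1 <= n)%nat ->
    is_scalar K a -> is_scalar K b -> is_scalar K m ->
    let I := open_interval l u in
    (forall x : R, I x -> w a b m x <> 0) ->
    let h := fun x : R => w_conj a b m x / w a b m x in
    (* the operational identity *)
    (forall y : R -> C, differentiable_on (n + 1) I y ->
       forall x : R, I x ->
         compose_down (fun k => D_minus (fun t => INR k * m * h t)) n y x
         = T n a b m y x)
    /\
    (* (i) *)
    (forall (lambda : C) (y0 : C -> C -> R -> C),
       is_scalar K lambda -> lambda <> 0 -> y0_form K lambda y0 ->
       let E0 : operator := fun y x => D (D y) x - lambda * y x in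
       let En : operator := fun y x =>
         D (D y) x - (lambda - potential n a b m x) * y x in
       general_solution K I E0 y0 /\
       (forall c1 c2 : C, is_scalar K c1 -> is_scalar K c2 ->
          solves I En (T n a b m (y0 c1 c2))) /\
       ((forall k : nat, (1 <= k <= n)%nat -> lambda <> (INR k * m) ^ 2) ->
          general_solution K I En (fun c1 c2 => T n a b m (y0 c1 c2))))
    /\
    (* (ii) *)
    (let E : operator := fun y x =>
       D (D y) x - m ^ 2 * (INR n + 1) ^ 2 * y x + potential n a b m x * y x in
     let p := fun x : R => m * (INR n + 1) * h x in
     (forall y : R -> C, differentiable_on 2 I y ->
        forall x : R, I x -> E y x = D_plus p (D_minus p y) x) /\
     (let f := fun x : R => / (w a b m x ^ (2 * (n + 1))) in
      (exists F : R -> C, antiderivative K I f F) /\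
      (forall F : R -> C, antiderivative K I f F ->
         general_solution K I E
           (fun c1 c2 x => w a b m x ^ (n + 1) * (c1 + c2 * F x))))).
Proof.
  intros K n a b m l u Hn Ka Kb Km I Hnz h.
  assert (HI : open I) by apply open_open_interval.
  assert (Kw : forall x, is_scalar K (w a b m x))
    by (intros x; unfold w; auto 6 with scalar).
  assert (Kh : forall x, is_scalar K (h x)).
  { intros x; unfold h, w_conj, Cdiv; auto 8 with scalar. }
  set (p := fun t => m * h t).
  assert (Kp : forall x, is_scalar K (p x)) by (intros x; unfold p; auto with scalar).
  assert (Hp : riccati I (m ^ 2) p) by (apply w_riccati; exact Hnz).
  assert (Hpot : forall x, I x ->
    potential n a b m x = INR n * (INR n + 1) * (m ^ 2 - p x * p x))
    by (intros x Hx; apply potential_riccati, Hnz, Hx).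
  assert (Hdw : forall x, I x -> is_deriveC (w a b m) x (p x * w a b m x)).
  { intros x Hx; eapply is_deriveC_eq; [apply is_deriveC_w|].
    unfold p, h; field; auto. }
  pose proof (w_smooth I a b m HI) as Hw.
  set (L := fun k : nat => D_minus (fun t => INR k * m * h t)).
  assert (HL : forall k z x, L k z x = D_minus (fun t => INR k * p t) z x)
    by (intros k z x; unfold L, D_minus, p; ring).
  assert (Hop : forall y, differentiable_on (n + 1) I y ->
    forall x, I x -> compose_down L n y x = T n a b m y x).
  { intros y Hy x Hx.
    exact (operational_identity I (w a b m) p L n y HI Hw Hnz Hdw HL Hy x Hx). }
  split; [exact Hop|split].
  - intros lambda y0 Kl Hl Hform E0 En.
    destruct (y0_form_fundamental_pair K lambda y0 Hl Hform) as (phi & psi & Hpair & ->).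
    assert (HE0 : forall y x, I x -> schrodinger lambda (fun _ => 0) y x = E0 y x)
      by (intros y x _; unfold schrodinger, E0; ring).
    assert (HT : forall c1 c2 x, I x ->
      compose_down L n (fun x => c1 * phi x + c2 * psi x) x =
      T n a b m (fun x => c1 * phi x + c2 * psi x) x).
    { intros c1 c2; apply Hop.
      apply (schrodinger_smooth I lambda (fun _ => 0)); [exact HI| |].
      - intros k; apply (differentiable_on_const I HI).
      - apply (fundamental_pair_solves K); assumption. }
    assert (HTsol : forall c1 c2,
      solves I En (T n a b m (fun x => c1 * phi x + c2 * psi x))).
    { intros c1 c2.
      apply (schrodinger_ext I lambda
        (fun x => INR n * (INR n + 1) * (m ^ 2 - p x * p x)) (potential n a b m)
        (compose_down L n (fun x => c1 * phi x + c2 * psi x)) _ HI).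
      - intros x Hx; symmetry; exact (Hpot x Hx).
      - apply HT.
      - apply darboux_chain_solves; auto.
        apply (fundamental_pair_solves K); assumption. }
    split; [|split].
    + apply (general_solution_ext K I (schrodinger lambda (fun _ => 0))); auto.
      apply fundamental_pair_general_solution; exact Hpair.
    + auto.
    + intros Hne y Ky; split.
      * intros Hy.
        destruct (darboux_chain_surjective K I lambda (m ^ 2) p y L n)
          as (v & Kv & Hv & Hvy); auto with scalar.
        -- (* k = 0 is the hypothesis that lambda is nonzero *)
           intros [|k] Hk.
           ++ intros H; apply Hl; rewrite H.
              change (RtoC (INR 0)) with (RtoC 0); ring.
           ++ intros H; apply (Hne (S k)); [lia|rewrite H; ring].
        -- exact (schrodinger_ext I lambda _ _ y y HI Hpot (fun _ _ => eq_refl) Hy).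
        -- destruct (proj1 (fundamental_pair_general_solution K l u lambda phi psi
                              Hpair v Kv) Hv) as (c1 & c2 & K1 & K2 & Hc).
           exists c1, c2; split; [exact K1|split; [exact K2|]].
           intros x Hx; rewrite <- HT, <- (Hvy x Hx) by exact Hx.
           apply (compose_down_ext I); [|exact Hc|exact Hx].
           intros k f g Hfg t Ht; unfold L, D_minus.
           rewrite (D_ext_on I HI f g Hfg t Ht), (Hfg t Ht); reflexivity.
      * intros (c1 & c2 & _ & _ & Hc).
        apply (schrodinger_ext I lambda (potential n a b m) _
          (T n a b m (fun x => c1 * phi x + c2 * psi x)) _ HI); [easy| |apply HTsol].
        intros x Hx; symmetry; exact (Hc x Hx).
  - intros E q.
    set (kappa := INR n + 1).
    assert (HE : forall y x, I x ->
      schrodinger (kappa ^ 2 * m ^ 2)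
        (fun t => kappa * (kappa - 1) * (m ^ 2 - p t * p t)) y x = E y x).
    { intros y x Hx; unfold E; rewrite (Hpot x Hx); unfold schrodinger, kappa; ring. }
    split.
    + intros y Hy x Hx; rewrite <- HE by exact Hx.
      rewrite <- (darboux_factorization I (m ^ 2) kappa p y HI Hp Hy x Hx).
      assert (Hq : forall t, kappa * p t = q t)
        by (intros t; unfold kappa, p, q; ring).
      unfold D_plus; f_equal.
      * apply (D_ext_on I HI); [|exact Hx].
        intros t _; unfold D_minus; rewrite Hq; reflexivity.
      * unfold D_minus; rewrite Hq; reflexivity.
    + intros f.
      assert (Hf : forall x, f x = / (w a b m x ^ (n + 1) * w a b m x ^ (n + 1))).
      { intros x; unfold f; rewrite <- Cpow_add_r; do 2 f_equal; lia. }
      split.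
      * apply antiderivative_exists.
        -- intros x Hx.
           refine (proj1 (differentiable_on_inv I HI 1 _ _ _) x Hx).
           ++ intros t Ht; apply Cpow_nz, Hnz, Ht.
           ++ apply (differentiable_on_pow I HI), Hw.
        -- intros x _; unfold f; auto with scalar.
      * intros F HF.
        refine (general_solution_ext K I _ E _ HI HE _).
        apply (riccati_general_solution K l u (m ^ 2) kappa p
          (fun x => w a b m x ^ (n + 1)) F); auto with scalar.
        -- unfold kappa; auto with scalar.
        -- intros x Hx; apply Cpow_nz, Hnz, Hx.
        -- intros x Hx; eapply is_deriveC_eq; [apply is_deriveC_pow, Hdw, Hx|].
           unfold kappa; rewrite plus_INR, RtoC_plus; reflexivity.
        -- intros x Hx; destruct (HF x Hx) as [KF HdF]; split; [exact KF|].
           rewrite <- Hf; exact HdF.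
Qed.
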